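(* Suppose $f=\frac1n\sum_{i=1}^n f_i$ is $\mu$-strongly convex and each $f_i$ has $L$-Lipschitz continuous gradient; let $\kappa=\frac L\mu$. Let $n_c\ge1$ and let $r_k$ be the error vectors of the gradient tracking algorithm with $n_g=1$ described in the context, with step size $\alpha>0$. Let $$A(n_c)=\begin{bmatrix} 1-\alpha\mu & \frac{\alpha L}{\sqrt n} & 0\\ 0 & \beta_1^{n_c} & \alpha\beta_2^{n_c}\\ \sqrt n\,\alpha\beta_4^{n_c}L^2 & \beta_4^{n_c}L\left(\|\mathbf{Z}_1^{n_c}-I_{nd}\|_2+\alpha L\right) & \beta_3^{n_c}+\alpha\beta_4^{n_c}L\end{bmatrix}.$$ If the matrix $A(n_c)$ is irreducible, $\beta_1,\beta_3<1$ and $$\alpha<\min\left\{\frac1L,\ \frac{1-\beta_3^{n_c}}{L\beta_4^{n_c}},\ \frac{1-\beta_1^{n_c}+2\beta_2^{n_c}}{2\beta_2^{n_c}\kappa(L+\mu)}\left(\sqrt{1+\frac{4(1-\beta_1^{n_c})(1-\beta_3^{n_c})\beta_2^{n_c}(\kappa+1)}{\beta_4^{n_c}(1-\beta_1^{n_c}+2\beta_2^{n_c})^2}}-1\right)\right\},$$ then $\rho(A(n_c))<1$, and for all $\epsilon>0$ there exists a constant $C_\epsilon>0$ such that, for all $k\ge0$, $$\|r_k\|_2\le C_\epsilon\left(\rho(A(n_c))+\epsilon\right)^k\|r_0\|_2.$$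
   Context: Functions: $f_i:\mathbb{R}^d\to\mathbb{R}$, $i=1,\dots,n$, are differentiable, $f=\frac1n\sum_{i=1}^n f_i$. $\mu$-strong convexity ($\mu>0$) means $f(z')\ge f(z)+\langle\nabla f(z),z'-z\rangle+\frac{\mu}{2}\|z'-z\|_2^2$ for all $z,z'\in\mathbb{R}^d$; $L$-Lipschitz gradients means $\|\nabla f_i(z)-\nabla f_i(z')\|_2\le L\|z-z'\|_2$ for all $z,z'$ and all $i$. $x^*$ is the unique minimizer of $f$. $\rho(\cdot)$ denotes spectral radius. Communication matrices: the $n$ nodes form a connected undirected network with edge set $\mathcal{E}$. A communication matrix $\mathbf{U}\in\mathbb{R}^{n\times n}$ is symmetric, doubly stochastic, with $u_{ii}>0$, $u_{ij}\ge0$ for $i\ne j$, $(i,j)\in\mathcal{E}$, and $u_{ij}=0$ for $i\neq j$, $(i,j)\notin\mathcal{E}$. $\mathbf{W}_1,\dots,\mathbf{W}_4$ are communication matrices, $\mathbf{Z}_i=\mathbf{W}_i\otimes I_d$, $\mathbf{Z}_i^{n_c}=\mathbf{W}_i^{n_c}\otimes I_d$ ($n_c$-th powers), and $\beta_i=\|\mathbf{W}_i-\frac{1_n1_n^T}{n}\|_2\in[0,1]$, so that $\beta_i^{n_c}=\|\mathbf{W}_i^{n_c}-\frac{1_n1_n^T}{n}\|_2$. Algorithm (with $n_g=1$): for $\mathbf{x}=(x_1,\dots,x_n)\in\mathbb{R}^{nd}$ write $\nabla\mathbf{f}(\mathbf{x})=(\nabla f_1(x_1),\dots,\nabla f_n(x_n))\in\mathbb{R}^{nd}$.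 Given $\mathbf{x}_0\in\mathbb{R}^{nd}$ arbitrary, $\mathbf{y}_0=\nabla\mathbf{f}(\mathbf{x}_0)$, and constant step size $\alpha>0$, for $k\ge0$: $\mathbf{x}_{k+1}=\mathbf{Z}_1^{n_c}\mathbf{x}_k-\alpha\mathbf{Z}_2^{n_c}\mathbf{y}_k$, $\ \mathbf{y}_{k+1}=\mathbf{Z}_3^{n_c}\mathbf{y}_k+\mathbf{Z}_4^{n_c}(\nabla\mathbf{f}(\mathbf{x}_{k+1})-\nabla\mathbf{f}(\mathbf{x}_k))$. Error vector: $\bar x_k=\frac1n\sum_i x_{i,k}$, $\bar y_k=\frac1n\sum_i y_{i,k}$; $\bar{\mathbf{x}}_k,\bar{\mathbf{y}}_k\in\mathbb{R}^{nd}$ are $\bar x_k,\bar y_k$ repeated $n$ times; $r_k=\left(\|\bar x_k-x^*\|_2,\ \|\mathbf{x}_k-\bar{\mathbf{x}}_k\|_2,\ \|\mathbf{y}_k-\bar{\mathbf{y}}_k\|_2\right)^T\in\mathbb{R}^3$. *)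

(* Defs.v *)
From mathcomp Require Import all_boot all_order all_algebra.
From mathcomp Require Import perm complex mxtens.
From mathcomp Require Import boolp classical_sets reals topology normedtype derive.

Set Implicit Arguments.
Unset Strict Implicit.
Unset Printing Implicit Defensive.

Import Order.TTheory GRing.Theory Num.Theory.
Import numFieldNormedType.Exports.

Local Open Scope classical_set_scope.
Local Open Scope ring_scope.

(* The canonical norm on matrices in MathComp-Analysis is the sup norm, so the
   Euclidean structure on 'cV[R]_m is introduced separately. Differentiability
   does not depend on this choice. *)
Definition dot (R : realType) (m : nat) (u v : 'cV[R]_m) : R :=
  \sum_(i < m) u i 0 * v i 0.

Definition norm2 (R : realType) (m : nat) (u : 'cV[R]_m) : R :=
  Num.sqrt (dot u u).

Definition opnorm2 (R : realType) (m p : nat) (A : 'M[R]_(m, p)) : R :=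
  sup [set norm2 (A *m u) | u in [set u : 'cV[R]_p | norm2 u <= 1]].

(* The eigenvalues are the complex ones, and normc is the modulus with values
   in R. *)
Definition spectral_radius (R : realType) (m : nat) (A : 'M[R]_m) : R :=
  sup [set Normc.normc l |
        l in [set l : R[i] | eigenvalue (map_mx (real_complex R) A) l]].

(* A is reducible when some simultaneous permutation of its rows and columns
   has the form [B C; 0 D] with square diagonal blocks of sizes r and m - r,
   both nonempty. *)
Definition reducible_mx (R : realType) (m : nat) (A : 'M[R]_m) : Prop :=
  exists (s : 'S_m) (r : nat), (0 < r < m)%N /\
    forall i j : 'I_m, (r <= i)%N -> (j < r)%N ->
      row_perm s (col_perm s A) i j = 0.

Definition irreducible_mx (R : realType) (m : nat) (A : 'M[R]_m) : Prop :=
  ~ reducible_mx A.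

Definition gradient (R : realType) (d : nat) (g : 'cV[R]_d -> R)
    (z : 'cV[R]_d) : 'cV[R]_d :=
  \col_(j < d) 'D_(delta_mx j 0) g z.

Definition strongly_convex (R : realType) (d : nat) (mu : R)
    (g : 'cV[R]_d -> R) : Prop :=
  forall z z' : 'cV[R]_d,
    g z + dot (gradient g z) (z' - z) + mu / 2 * norm2 (z' - z) ^+ 2 <= g z'.

Definition lipschitz_gradient (R : realType) (d : nat) (L : R)
    (g : 'cV[R]_d -> R) : Prop :=
  forall z z' : 'cV[R]_d,
    norm2 (gradient g z - gradient g z') <= L * norm2 (z - z').

Definition minimizer (T : Type) (R : realType) (g : T -> R) (z : T) : Prop :=
  forall z' : T, g z <= g z'.

Definition unique_minimizer (T : Type) (R : realType) (g : T -> R) (z : T) :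
    Prop :=
  minimizer g z /\ forall z' : T, minimizer g z' -> z' = z.

Definition average (R : realType) (n d : nat) (f : 'I_n -> 'cV[R]_d -> R)
    (z : 'cV[R]_d) : R :=
  n%:R^-1 * \sum_(i < n) f i z.

Definition connected_graph (n : nat) (E : rel 'I_n) : Prop :=
  symmetric E /\ forall i j : 'I_n, connect E i j.

Record communication_matrix (R : realType) (n : nat) (E : rel 'I_n)
    (U : 'M[R]_n) : Prop := CommunicationMatrix {
  comm_sym : U^T = U;
  comm_row_sum : forall i, \sum_(j < n) U i j = 1;
  comm_col_sum : forall j, \sum_(i < n) U i j = 1;
  comm_diag : forall i, 0 < U i i;
  comm_edge : forall i j, i != j -> E i j -> 0 <= U i j;
  comm_nonedge : forall i j, i != j -> ~~ E i j -> U i j = 0 }.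

Definition beta (R : realType) (n : nat) (W : 'M[R]_n) : R :=
  opnorm2 (W - const_mx n%:R^-1).

(* Vectors of R^(nd) are stored as 'cV[R]_(n * d), and the j-th coordinate of
   the i-th node sits at position mxtens_index (i, j) = i * d + j, which is the
   indexing used by the Kronecker product *t. *)
Definition node (R : realType) (n d : nat) (x : 'cV[R]_(n * d)) (i : 'I_n) :
    'cV[R]_d :=
  \col_(j < d) x (mxtens_index (i, j)) 0.

Definition stack (R : realType) (n d : nat) (v : 'I_n -> 'cV[R]_d) :
    'cV[R]_(n * d) :=
  \col_(k < n * d) v (mxtens_unindex k).1 (mxtens_unindex k).2 0.

Definition mean (R : realType) (n d : nat) (x : 'cV[R]_(n * d)) : 'cV[R]_d :=
  n%:R^-1 *: \sum_(i < n) node x i.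

Definition consensus_error (R : realType) (n d : nat) (x : 'cV[R]_(n * d)) :
    'cV[R]_(n * d) :=
  x - stack (fun _ : 'I_n => mean x).

Definition stacked_gradient (R : realType) (n d : nat)
    (f : 'I_n -> 'cV[R]_d -> R) (x : 'cV[R]_(n * d)) : 'cV[R]_(n * d) :=
  stack (fun i => gradient (f i) (node x i)).

Definition comm_lift (R : realType) (n d nc : nat) (W : 'M[R]_n) :
    'M[R]_(n * d) :=
  (W ^+ nc) *t (1%:M : 'M[R]_d).

Record gradient_tracking (R : realType) (n d nc : nat)
    (W1 W2 W3 W4 : 'M[R]_n) (f : 'I_n -> 'cV[R]_d -> R) (alpha : R)
    (x y : nat -> 'cV[R]_(n * d)) : Prop := GradientTracking {
  gt_init : y 0%N = stacked_gradient f (x 0%N);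
  gt_x : forall k,
    x k.+1 = comm_lift d nc W1 *m x k - alpha *: (comm_lift d nc W2 *m y k);
  gt_y : forall k,
    y k.+1 = comm_lift d nc W3 *m y k
             + comm_lift d nc W4
               *m (stacked_gradient f (x k.+1) - stacked_gradient f (x k)) }.

Definition error_vector (R : realType) (n d : nat) (xstar : 'cV[R]_d)
    (x y : 'cV[R]_(n * d)) : 'cV[R]_3 :=
  \col_(i < 3) [:: norm2 (mean x - xstar);
                   norm2 (consensus_error x);
                   norm2 (consensus_error y)]`_i.

Definition tracking_matrix (R : realType) (n d nc : nat)
    (W1 W2 W3 W4 : 'M[R]_n) (mu L alpha : R) : 'M[R]_3 :=
  let b1 := beta W1 ^+ nc in
  let b2 := beta W2 ^+ nc in
  let b3 := beta W3 ^+ nc in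
  let b4 := beta W4 ^+ nc in
  let sn := Num.sqrt (n%:R : R) in
  \matrix_(i < 3, j < 3)
    (nth [::]
      [:: [:: 1 - alpha * mu; alpha * L / sn; 0];
          [:: 0; b1; alpha * b2];
          [:: sn * alpha * b4 * L ^+ 2;
              b4 * L * (opnorm2 (comm_lift d nc W1 - 1%:M) + alpha * L);
              b3 + alpha * b4 * L]] i)`_j.

(* Main.v *)
Require Import Defs.
From mathcomp Require Import all_boot all_order all_algebra.
From mathcomp Require Import perm complex mxtens ring lra.
From mathcomp Require Import boolp classical_sets functions reals.
From mathcomp Require Import topology normedtype derive.

Set Implicit Arguments.
Unset Strict Implicit.
Unset Printing Implicit Defensive.

Import Order.TTheory GRing.Theory Num.Theory.
Import numFieldNormedType.Exports.

Local Open Scope ring_scope.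

(** The error vectors satisfy r_{k+1} <= A r_k entrywise
    ([error_vector_step]), A is nonnegative, and the theorem follows from two
    facts on A: its spectral radius is smaller than 1, and the entries of its
    powers are O((rho(A) + eps) ^ k).

    One iteration.  Doubly stochastic communication preserves means, so the mean
    of y_k is always the mean of the local gradients ([tracking_invariant]), and
    the mean of x_k moves by a gradient step on f perturbed by the consensus
    error.  An exact step contracts the distance to the minimizer by
    1 - alpha mu ([gradient_step_contraction]); this rests on the cocoercivity of
    grad f - mu id, itself a consequence of the descent lemma.  The descent lemma
    is proved by repeated halving of a segment, which uses convexity and the
    Lipschitz bound but no integral.  On consensus errors, W ^ nc acts as
    (W - J) ^ nc with J the averaging matrix ([centering_expmx]), whence the
    factors beta ^ nc; the displacement x_{k+1} - x_k that drives the tracking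
    error is bounded in [displacement_le].

    Spectral radius.  If v is positive and A v < v, weighting the moduli of a
    left eigenvector by v shows that every eigenvalue has modulus less than 1
    ([spectral_radius_lt1]).  For the matrix at hand, v is read off the adjugate
    of 1 - A, and is positive once \det (1 - A) > 0.  Bounding |Z_1 ^ nc - 1| by
    2 turns this condition into a quadratic inequality in alpha, which is what
    the third bound on the step size solves ([step_size_quadratic]).
    Irreducibility enters through the positivity of beta_2 ^ nc and beta_4 ^ nc.

    Growth of powers.  By Cayley and Hamilton, a product of factors A - l over
    eigenvalues l vanishes; removing these factors one at a time bounds the
    powers of A ([powers_le_spectral_radius]).  The constant depends on A
    only, hence not on the trajectory. *)

(** * The Euclidean norm and the operator norm *)

Section Euclidean.
Variables (R : realType) (m : nat).
Implicit Types (u v w : 'cV[R]_m) (a : R).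

Lemma dotC u v : dot u v = dot v u.
Proof. by apply: eq_bigr => i _; rewrite mulrC. Qed.

Lemma dotDl u v w : dot (u + v) w = dot u w + dot v w.
Proof. by rewrite -big_split; apply: eq_bigr => i _; rewrite !mxE mulrDl. Qed.

Lemma dotZl a u v : dot (a *: u) v = a * dot u v.
Proof. by rewrite mulr_sumr; apply: eq_bigr => i _; rewrite !mxE mulrA. Qed.

Lemma dotNl u v : dot (- u) v = - dot u v.
Proof. by rewrite -scaleN1r dotZl mulN1r. Qed.

Lemma dotDr u v w : dot u (v + w) = dot u v + dot u w.
Proof. by rewrite dotC dotDl !(dotC u). Qed.

Lemma dotZr a u v : dot u (a *: v) = a * dot u v.
Proof. by rewrite dotC dotZl dotC. Qed.

Lemma dotNr u v : dot u (- v) = - dot u v.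
Proof. by rewrite dotC dotNl dotC. Qed.

Definition dotE := (dotDl, dotDr, dotNl, dotNr, dotZl, dotZr).

Lemma dot_ge0 u : 0 <= dot u u.
Proof. by apply: sumr_ge0 => i _; rewrite -expr2 sqr_ge0. Qed.

Lemma norm2_ge0 u : 0 <= norm2 u.
Proof. exact: sqrtr_ge0. Qed.

Lemma sqr_norm2 u : norm2 u ^+ 2 = dot u u.
Proof. by rewrite sqr_sqrtr ?dot_ge0. Qed.

Lemma norm2_le u a : 0 <= a -> dot u u <= a ^+ 2 -> norm2 u <= a.
Proof. by move=> a0; rewrite -sqr_norm2 ler_pXn2r ?nnegrE ?norm2_ge0. Qed.

Lemma norm2_eq0 u : norm2 u = 0 -> u = 0.
Proof.
move=> u0; have /eqP := sqr_norm2 u; rewrite u0 expr0n /= eq_sym.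
rewrite psumr_eq0 => [/allP du|i _]; last by rewrite -expr2 sqr_ge0.
apply/colP => i; have := du i (mem_index_enum i).
by rewrite /= mulf_eq0 orbb mxE => /eqP.
Qed.

Lemma norm2_0 : norm2 (0 : 'cV[R]_m) = 0.
Proof. by rewrite /norm2 -(scale0r 0) dotZl mul0r sqrtr0. Qed.

Lemma norm2Z a u : norm2 (a *: u) = `|a| * norm2 u.
Proof.
by rewrite /norm2 !dotE mulrA -expr2 sqrtrM ?sqr_ge0 // sqrtr_sqr.
Qed.

Lemma norm2N u : norm2 (- u) = norm2 u.
Proof. by rewrite -scaleN1r norm2Z normrN1 mul1r. Qed.

Lemma cauchy_schwarz u v : dot u v <= norm2 u * norm2 v.
Proof.
have [u0|u0] := eqVneq (norm2 u) 0.
  by rewrite u0 mul0r (norm2_eq0 u0) -(scale0r 0) dotZl mul0r.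
have [v0|v0] := eqVneq (norm2 v) 0.
  by rewrite v0 mulr0 (norm2_eq0 v0) -(scale0r 0) dotZr mul0r.
have ugt0 : 0 < norm2 u by rewrite lt_def u0 norm2_ge0.
have vgt0 : 0 < norm2 v by rewrite lt_def v0 norm2_ge0.
have := dot_ge0 (norm2 v *: u - norm2 u *: v).
rewrite !dotE -!sqr_norm2 (dotC v u) => h.
have p : 0 < norm2 u * norm2 v by rewrite mulr_gt0.
rewrite -(ler_pM2l p) -subr_ge0 -(pmulr_rge0 _ (ltr0n R 2)).
by apply: le_trans h _; rewrite le_eqVlt; apply/orP; left; apply/eqP; ring.
Qed.

Lemma norm2D u v : norm2 (u + v) <= norm2 u + norm2 v.
Proof.
apply: norm2_le; first by rewrite addr_ge0 ?norm2_ge0.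
rewrite !dotE sqrrD !sqr_norm2 (dotC v u).
have := cauchy_schwarz u v; lra.
Qed.

Lemma norm2B u v : norm2 (u - v) <= norm2 u + norm2 v.
Proof. by apply: le_trans (norm2D _ _) _; rewrite norm2N. Qed.

Lemma distn2C u v : norm2 (u - v) = norm2 (v - u).
Proof. by rewrite -norm2N opprB. Qed.

Lemma norm2_delta j : norm2 (delta_mx j 0 : 'cV[R]_m) = 1.
Proof.
rewrite /norm2 /dot (bigD1 j) //= big1 ?addr0 => [|i /negbTE ij].
  by rewrite !mxE !eqxx mulr1 sqrtr1.
by rewrite !mxE ij mul0r.
Qed.

End Euclidean.

Section OperatorNorm.
Variables (R : realType) (m p : nat).
Implicit Type A : 'M[R]_(m, p).

Let image_unit_ball A : set R :=
  [set norm2 (A *m u) | u in [set u : 'cV[R]_p | norm2 u <= 1]]%classic.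

Lemma opnorm2_has_ubound A : has_ubound (image_unit_ball A).
Proof.
exists (Num.sqrt (\sum_i norm2 (row i A)^T ^+ 2)) => _ [u /= u1 <-].
apply: norm2_le; first exact: sqrtr_ge0.
rewrite sqr_sqrtr; last by apply: sumr_ge0 => i _; exact: sqr_ge0.
apply: ler_sum => i _; rewrite -expr2.
have -> : (A *m u) i 0 = dot (row i A)^T u.
  by rewrite mxE; apply: eq_bigr => j _; rewrite !mxE.
rewrite -real_normK ?num_real // ler_pXn2r ?nnegrE ?norm2_ge0 //.
have bound v : norm2 v <= 1 -> dot (row i A)^T v <= norm2 (row i A)^T.
  move=> v1; apply: le_trans (cauchy_schwarz _ _) _.
  by rewrite ler_piMr ?norm2_ge0.
by rewrite ler_norml bound // lerNl -dotNr bound // norm2N.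
Qed.

Lemma opnorm2_ge0 A : 0 <= opnorm2 A.
Proof.
apply: (ub_le_sup (opnorm2_has_ubound A)); exists 0 => /=.
  by rewrite norm2_0 ler01.
by rewrite mulmx0 norm2_0.
Qed.

Lemma norm2_mulmx_le A (u : 'cV[R]_p) :
  norm2 (A *m u) <= opnorm2 A * norm2 u.
Proof.
have [u0|u0] := eqVneq (norm2 u) 0.
  by rewrite (norm2_eq0 u0) mulmx0 !norm2_0 mulr0.
have ugt0 : 0 < norm2 u by rewrite lt_def u0 norm2_ge0.
rewrite -ler_pdivrMr // mulrC.
apply: (ub_le_sup (opnorm2_has_ubound A)); exists ((norm2 u)^-1 *: u) => /=.
  by rewrite norm2Z gtr0_norm ?invr_gt0 // mulVf.
by rewrite -scalemxAr norm2Z gtr0_norm ?invr_gt0.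
Qed.

Lemma opnorm2_le A (c : R) : 0 <= c ->
  (forall u : 'cV[R]_p, norm2 (A *m u) <= c * norm2 u) -> opnorm2 A <= c.
Proof.
move=> c0 Ac; apply: ge_sup.
  by exists 0, 0; rewrite /= ?mulmx0 norm2_0 ?ler01.
move=> _ [u /= u1 <-]; apply: le_trans (Ac u) _.
by rewrite ler_piMr.
Qed.

End OperatorNorm.

Lemma norm2_expmx_le (R : realType) (n k : nat) (A : 'M[R]_n) (c : R) :
  0 <= c -> (forall u, norm2 (A *m u) <= c * norm2 u) ->
  forall u, norm2 (A ^+ k *m u) <= c ^+ k * norm2 u.
Proof.
move=> c0 Ac; elim: k => [|k IH] u; first by rewrite !expr0 mul1mx mul1r.
rewrite [A ^+ _]exprS -mulmxA exprS -mulrA.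
by apply: le_trans (Ac _) _; rewrite ler_wpM2l.
Qed.

(** * A gradient step contracts *)

Section GradientStep.
Variables (R : realType) (d : nat) (mu L : R).
Variables (g : 'cV[R]_d -> R) (G : 'cV[R]_d -> 'cV[R]_d).
Implicit Types z w x y : 'cV[R]_d.

Hypothesis mu_gt0 : 0 < mu.
Hypothesis lower : forall z z',
  g z + dot (G z) (z' - z) + mu / 2 * norm2 (z' - z) ^+ 2 <= g z'.
Hypothesis G_lip : forall z z', norm2 (G z - G z') <= L * norm2 (z - z').

Lemma dot_increment_le z w :
  dot (G (z + w)) w <= dot (G z) w + L * norm2 w ^+ 2.
Proof.
have := cauchy_schwarz (G (z + w) - G z) w; rewrite dotDl dotNl.
have := G_lip (z + w) z; rewrite [z + w - z]addrC addKr => h.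
have := ler_wpM2r (norm2_ge0 w) h; lra.
Qed.

Let upper_with c := forall z w, g (z + w) <= g z + dot (G z) w + c * norm2 w ^+ 2.

Lemma upper_with_lipschitz : upper_with L.
Proof.
move=> z w; have := lower (z + w) z; have := dot_increment_le z w.
rewrite opprD addNKr dotNr norm2N.
have := mulr_ge0 (ltW mu_gt0) (sqr_ge0 (norm2 w)); lra.
Qed.

(** Applying the bound on each half of the segment [z, z + w] costs only the
    variation of G over half of it, which sends c to c / 2 + L / 4. *)
Lemma upper_with_halve c : upper_with c -> upper_with (c / 2 + L / 4).
Proof.
move=> up z w; set h : R := 2^-1.
have e : z + w = (z + h *: w) + h *: w.
  by rewrite -addrA -scalerDl [h + h](_ : _ = 1) ?scale1r // /h; lra.
have := up z (h *: w); have := up (z + h *: w) (h *: w); rewrite -e.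
have := dot_increment_le z (h *: w).
rewrite !dotZr !norm2Z ger0_norm ?invr_ge0 // /h; lra.
Qed.

(** The fixed point of c |-> c / 2 + L / 4 is the constant L / 2 of the usual
    descent lemma, reached here without integrating along the segment. *)
Lemma descent_lemma z w :
  g (z + w) <= g z + dot (G z) w + L / 2 * norm2 w ^+ 2.
Proof.
have up k : upper_with (L / 2 + L / 2 / 2 ^+ k).
  elim: k => [|k IH].
    by rewrite expr0 divr1 -splitr; exact: upper_with_lipschitz.
  have := upper_with_halve IH; congr upper_with.
  by rewrite exprS; field; rewrite expf_neq0 ?pnatr_eq0.
rewrite leNgt; apply/negP => lt.
pose gap := g (z + w) - (g z + dot (G z) w + L / 2 * norm2 w ^+ 2).
have gap_gt0 : 0 < gap by rewrite subr_gt0.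
pose B := L / 2 * norm2 w ^+ 2.
have gap_le k : gap * 2 ^+ k <= B.
  have p2 : 0 < (2 ^+ k : R) by rewrite exprn_gt0.
  rewrite -ler_pdivlMr // /gap /B.
  by have := up k z w; lra.
have B0 : 0 <= B / gap.
  by rewrite divr_ge0 // ?ltW //; have := gap_le 0%N; rewrite expr0; lra.
have := gap_le (Num.bound (B / gap)); rewrite mulrC -ler_pdivlMr // leNgt.
move=> /negP; apply; apply: lt_trans (archi_boundP B0) _.
by rewrite -natrX ltr_nat ltn_expl.
Qed.

Lemma strong_monotonicity x y :
  mu * norm2 (x - y) ^+ 2 <= dot (G x - G y) (x - y).
Proof.
have := lower x y; have := lower y x; rewrite (distn2C y x) -(opprB x y) dotNr.
by rewrite dotDl dotNl; lra.
Qed.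

Lemma strong_convexity_le_lipschitz : (0 < d)%N -> mu <= L.
Proof.
move=> d_gt0; pose u : 'cV[R]_d := delta_mx (Ordinal d_gt0) 0.
have u1 : norm2 u = 1 by exact: norm2_delta.
have := strong_monotonicity u 0; have := dot_increment_le 0 u.
by rewrite add0r subr0 u1 dotDl dotNl; lra.
Qed.

(** Moving from the minimizer along - G / L would decrease g by at least
    |G|^2 / (2 L), by the descent lemma. *)
Lemma gradient_minimizer_eq0 x : 0 < L -> minimizer g x -> G x = 0.
Proof.
move=> L0 xmin; apply: norm2_eq0; apply/eqP; rewrite -sqrf_eq0 eq_le sqr_ge0.
rewrite andbT; have := le_trans (xmin _) (descent_lemma x (- L^-1 *: G x)).
rewrite dotZr -sqr_norm2 norm2Z normrN gtr0_norm ?invr_gt0 // exprMn.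
have -> : L / 2 * (L^-1 ^+ 2 * norm2 (G x) ^+ 2) = L^-1 * norm2 (G x) ^+ 2 / 2.
  by field; rewrite gt_eqF.
rewrite -addrA lerDl => h; rewrite -(pmulr_rle0 (x := L^-1)) ?invr_gt0 //.
by move: h; lra.
Qed.

(** The map H = G - mu id is the gradient of the convex function
    h = g - (mu / 2) |.|^2, whose descent constant is (L - mu) / 2.  Comparing
    the tangent of h at y with the descent bound at x, both evaluated at
    x - t (H x - H y), and adding the same inequality with x and y exchanged,
    eliminates the values of h. *)
Lemma shifted_gradient_cocoercive x y t :
  let D := G x - G y - mu *: (x - y) in
  (2 * t - (L - mu) * t ^+ 2) * norm2 D ^+ 2 <= dot D (x - y).
Proof.
pose H z := G z - mu *: z; pose h z := g z - mu / 2 * norm2 z ^+ 2.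
have h_low z w : h z + dot (H z) w <= h (z + w).
  have := lower z (z + w); rewrite [z + w - z]addrC addKr /h /H !sqr_norm2.
  by rewrite !dotE (dotC w z); lra.
have h_up z w : h (z + w) <= h z + dot (H z) w + (L - mu) / 2 * norm2 w ^+ 2.
  have := descent_lemma z w; rewrite /h /H !sqr_norm2.
  by rewrite !dotE (dotC w z); lra.
have half z1 z2 : h z2 - h z1 + dot (H z2) (z1 - z2)
    + (t - (L - mu) / 2 * t ^+ 2) * norm2 (H z1 - H z2) ^+ 2 <= 0.
  set E := H z1 - H z2.
  have := h_low z2 (z1 - z2 + - t *: E); have := h_up z1 (- t *: E).
  rewrite addrA subrKC norm2Z normrN exprMn real_normK ?num_real // => up low.
  have Esq : norm2 E ^+ 2 = dot (H z1) E - dot (H z2) E.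
    by rewrite sqr_norm2 {1}/E dotDl dotNl.
  by have := le_trans low up; rewrite dotDr !dotZr Esq; lra.
rewrite /=; set D := G x - _ - _.
have DE : D = H x - H y.
  by apply/colP => i; rewrite !mxE; ring.
have := half x y; have := half y x.
rewrite (distn2C (H y)) -DE -(opprB x y) dotNr.
have -> : dot D (x - y) = dot (H x) (x - y) - dot (H y) (x - y).
  by rewrite DE dotDl dotNl.
by lra.
Qed.

(** Write x - a G x = (1 - a mu) x - a H x with H = G - mu id as above; the
    cocoercivity of H makes the H part of the squared norm nonpositive.  The
    parameter t = a / (1 - a mu) is admissible because (L - mu) t <= 1 is
    a L <= 1. *)
Lemma gradient_step_contraction x y a : mu <= L -> 0 < a -> a * L < 1 ->
  norm2 (x - y - a *: (G x - G y)) <= (1 - a * mu) * norm2 (x - y).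
Proof.
move=> muL a0 aL1; set s := 1 - a * mu.
have s0 : 0 < s by rewrite subr_gt0 (le_lt_trans _ aL1) // ler_wpM2l // ltW.
have := shifted_gradient_cocoercive x y (a / s); rewrite /=.
set D := G x - _ - _ => coco.
have -> : x - y - a *: (G x - G y) = s *: (x - y) - a *: D.
  by apply/colP => i; rewrite !mxE /s; ring.
move: D (x - y) coco => D w coco.
apply: norm2_le; first by rewrite mulr_ge0 ?norm2_ge0 // ltW.
rewrite !dotE (dotC w D) exprMn sqr_norm2 -(sqr_norm2 D).
have coef : a <= 2 * s * (2 * (a / s) - (L - mu) * (a / s) ^+ 2).
  have -> : 2 * s * (2 * (a / s) - (L - mu) * (a / s) ^+ 2)
      = 4 * a - 2 * a * (a * (L - mu) / s).
    by field; rewrite gt_eqF.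
  have q1 : a * (L - mu) / s <= 1 by rewrite ler_pdivrMr // mul1r /s; lra.
  have := ler_wpM2l (ltW a0) q1; lra.
move: coco coef; set c := 2 * _ - _ => coco coef.
have aD : a * norm2 D ^+ 2 <= 2 * s * dot D w.
  have := ler_wpM2r (sqr_ge0 (norm2 D)) coef.
  by have := ler_wpM2l (ltW s0) coco; lra.
by have := ler_wpM2l (ltW a0) aD; lra.
Qed.

End GradientStep.

(** * Averaging over the nodes *)

Section Stacking.
Variables (R : realType) (n d : nat).
Implicit Types (x : 'cV[R]_(n * d)) (A B : 'M[R]_n).

Lemma sum_mxtens_index (F : 'I_(n * d) -> R) :
  \sum_k F k = \sum_(i < n) \sum_(j < d) F (mxtens_index (i, j)).
Proof.
rewrite pair_big; apply: reindex => /=; exists (@mxtens_unindex n d).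
  by move=> [i j] _; rewrite mxtens_indexK.
by move=> k _; rewrite -surjective_pairing mxtens_unindexK.
Qed.

Lemma norm2_node x : norm2 x ^+ 2 = \sum_i norm2 (node x i) ^+ 2.
Proof.
rewrite sqr_norm2 /dot sum_mxtens_index; apply: eq_bigr => i _.
by rewrite sqr_norm2; apply: eq_bigr => j _; rewrite !mxE.
Qed.

Lemma node_stack (v : 'I_n -> 'cV[R]_d) i : node (stack v) i = v i.
Proof. by apply/colP => j; rewrite !mxE mxtens_indexK. Qed.

Lemma nodeB x x' i : node (x - x') i = node x i - node x' i.
Proof. by apply/colP => j; rewrite !mxE. Qed.

Lemma stack_node x : stack (node x) = x.
Proof. by apply/colP => k; rewrite !mxE -surjective_pairing mxtens_unindexK. Qed.

Lemma node_inj x x' : node x =1 node x' -> x = x'.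
Proof.
by move=> e; rewrite -(stack_node x) -(stack_node x'); congr stack; apply/funext.
Qed.

Lemma node_tensmx A x i :
  node ((A *t (1%:M : 'M_d)) *m x) i = \sum_k A i k *: node x k.
Proof.
apply/colP => j; rewrite !mxE sum_mxtens_index summxE; apply: eq_bigr => k _.
rewrite (bigD1 j) //= big1 ?addr0 => [|l /negbTE lj].
  by rewrite tensmxE !mxE eqxx mulr1.
by rewrite tensmxE !mxE eq_sym lj mulr0 mul0r.
Qed.

Lemma tensmx1B A B :
  (A - B) *t (1%:M : 'M[R]_d) = A *t (1%:M : 'M_d) - B *t (1%:M : 'M_d).
Proof. by apply/matrixP => i j; rewrite !mxE mulrBl. Qed.

Lemma tens1mx1_mulmx x : ((1%:M : 'M_n) *t (1%:M : 'M_d)) *m x = x.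
Proof.
apply: node_inj => i; rewrite node_tensmx (bigD1 i) //= big1 => [|k /negbTE ki].
  by rewrite mxE eqxx scale1r addr0.
by rewrite mxE eq_sym ki scale0r.
Qed.

(** The squared norm of a stacked vector is also the sum over the d coordinates
    of the squared norms of their slices across the nodes, and the Kronecker
    lift of A acts on each slice as A. *)
Lemma norm2_tensmx_le A (c : R) x : 0 <= c ->
  (forall u : 'cV_n, norm2 (A *m u) <= c * norm2 u) ->
  norm2 ((A *t (1%:M : 'M_d)) *m x) <= c * norm2 x.
Proof.
move=> c0 Ac; pose slice (z : 'cV[R]_(n * d)) (j : 'I_d) : 'cV[R]_n :=
  \col_i (node z i) j 0.
have sliceE z : norm2 z ^+ 2 = \sum_j norm2 (slice z j) ^+ 2.
  rewrite norm2_node; under eq_bigr do rewrite sqr_norm2.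
  under [RHS]eq_bigr do rewrite sqr_norm2.
  rewrite exchange_big; apply: eq_bigr => j _; apply: eq_bigr => i _.
  by rewrite !mxE.
have slice_lift j : slice ((A *t 1%:M) *m x) j = A *m slice x j.
  apply/colP => i; rewrite mxE node_tensmx summxE mxE.
  by apply: eq_bigr => k _; rewrite !mxE.
apply: norm2_le; first by rewrite mulr_ge0 ?norm2_ge0.
rewrite -sqr_norm2 sliceE exprMn sliceE mulr_sumr; apply: ler_sum => j _.
by rewrite slice_lift -exprMn ler_pXn2r ?nnegrE ?mulr_ge0 ?norm2_ge0.
Qed.

Lemma norm2_stack_cst (v : 'cV[R]_d) :
  norm2 (stack (fun _ : 'I_n => v)) = Num.sqrt n%:R * norm2 v.
Proof.
apply/eqP; rewrite -(@eqrXn2 _ 2) ?mulr_ge0 ?sqrtr_ge0 ?norm2_ge0 //.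
rewrite norm2_node exprMn sqr_sqrtr // mulr_natl.
by under eq_bigr do rewrite node_stack; rewrite sumr_const card_ord.
Qed.

End Stacking.

Definition averaging (R : realType) (n : nat) : 'M[R]_n := const_mx n%:R^-1.

Definition doubly_stochastic (R : realType) (n : nat) (W : 'M[R]_n) : Prop :=
  [/\ forall i j, 0 <= W i j, forall i, \sum_j W i j = 1
    & forall j, \sum_i W i j = 1].

Section Averaging.
Variables (R : realType) (n d : nat).
Hypothesis n_gt0 : (0 < n)%N.
Implicit Types (W : 'M[R]_n) (x : 'cV[R]_(n * d)).
Local Notation J := (averaging R n).

Let n_neq0 : n%:R != 0 :> R. Proof. by rewrite pnatr_eq0 -lt0n. Qed.

Lemma communication_matrix_doubly_stochastic (E : rel 'I_n) W :
  communication_matrix E W -> doubly_stochastic W.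
Proof.
case=> _ rows cols diag edge nonedge; split=> // i j.
have [->|ij] := eqVneq i j; first exact/ltW/diag.
by have [Eij|Eij] := boolP (E i j); [exact: edge|rewrite nonedge].
Qed.

Lemma averaging_doubly_stochastic : doubly_stochastic J.
Proof.
split=> [i j|i|j]; first by rewrite mxE invr_ge0 ler0n.
  by under eq_bigr do rewrite mxE; rewrite sumr_const card_ord -[_ *+ n]mulr_natl mulfV.
by under eq_bigr do rewrite mxE; rewrite sumr_const card_ord -[_ *+ n]mulr_natl mulfV.
Qed.

(** Jensen's inequality for the square along each row, and then the column sums
    when the rows are added. *)
Lemma doubly_stochastic_contracts W (u : 'cV[R]_n) :
  doubly_stochastic W -> norm2 (W *m u) <= norm2 u.
Proof.
move=> [W0 rows cols]; apply: norm2_le; first exact: norm2_ge0.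
have jensen i : (W *m u) i 0 ^+ 2 <= \sum_j W i j * u j 0 ^+ 2.
  set m := (W *m u) i 0; rewrite -subr_ge0.
  have -> : \sum_j W i j * u j 0 ^+ 2 - m ^+ 2
      = \sum_j W i j * (u j 0 - m) ^+ 2.
    have mE : \sum_j W i j * u j 0 = m by rewrite /m mxE.
    transitivity (\sum_j (W i j * u j 0 ^+ 2 - 2 * m * (W i j * u j 0)
                            + m ^+ 2 * W i j)).
      by rewrite big_split sumrB /= -!mulr_sumr mE rows; ring.
    by apply: eq_bigr => j _; ring.
  by apply: sumr_ge0 => j _; rewrite mulr_ge0 ?sqr_ge0.
rewrite sqr_norm2 /dot; under eq_bigr do rewrite -expr2.
apply: le_trans (ler_sum _ (fun i _ => jensen i)) _.
rewrite exchange_big le_eqVlt; apply/orP; left; apply/eqP.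
by apply: eq_bigr => j _; rewrite -mulr_suml cols mul1r expr2.
Qed.

Lemma averaging_mulmx W : doubly_stochastic W -> J *m W = J.
Proof.
case=> _ _ cols; apply/matrixP => i j; rewrite !mxE.
by under eq_bigr do rewrite mxE; rewrite -mulr_sumr cols mulr1.
Qed.

Lemma mulmx_averaging W : doubly_stochastic W -> W *m J = J.
Proof.
case=> _ rows _; apply/matrixP => i j; rewrite !mxE.
by under eq_bigr do rewrite mxE; rewrite -mulr_suml rows mul1r.
Qed.

Lemma averaging_expmx W k : doubly_stochastic W -> J *m W ^+ k = J.
Proof.
move=> dsW; elim: k => [|k IH]; first by rewrite expr0 mulmx1.
by rewrite [W ^+ _]exprSr mulmxA IH averaging_mulmx.
Qed.

Lemma expmx_averaging W k : doubly_stochastic W -> W ^+ k *m J = J.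
Proof.
move=> dsW; elim: k => [|k IH]; first by rewrite expr0 mul1mx.
by rewrite [W ^+ _]exprS -mulmxA IH mulmx_averaging.
Qed.

Lemma centering_expmx W k : doubly_stochastic W ->
  (1%:M - J) *m W ^+ k = (W - J) ^+ k *m (1%:M - J).
Proof.
move=> dsW; have JJ := averaging_mulmx averaging_doubly_stochastic.
elim: k => [|k IH]; first by rewrite !expr0 mulmx1 mul1mx.
rewrite [W ^+ _]exprSr [in RHS]exprSr mulmxA IH -!mulmxA; congr (_ *m _).
rewrite !mulmxBl !mulmxBr !mul1mx !mulmx1.
by rewrite averaging_mulmx // mulmx_averaging // JJ subrr subr0.
Qed.

Lemma stack_mean x :
  stack (fun _ : 'I_n => mean x) = (J *t (1%:M : 'M_d)) *m x.
Proof.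
apply: node_inj => i; rewrite node_stack node_tensmx /mean scaler_sumr.
by apply: eq_bigr => k _; rewrite mxE.
Qed.

Lemma consensus_errorE x :
  consensus_error x = ((1%:M - J) *t (1%:M : 'M_d)) *m x.
Proof.
by rewrite /consensus_error stack_mean tensmx1B mulmxBl tens1mx1_mulmx.
Qed.

Lemma consensus_errorD x x' :
  consensus_error (x + x') = consensus_error x + consensus_error x'.
Proof. by rewrite !consensus_errorE mulmxDr. Qed.

Lemma consensus_errorZ a x : consensus_error (a *: x) = a *: consensus_error x.
Proof. by rewrite !consensus_errorE scalemxAr. Qed.

Lemma mean_eq x x' :
  (J *t (1%:M : 'M_d)) *m x = (J *t (1%:M : 'M_d)) *m x' -> mean x = mean x'.
Proof.
rewrite -!stack_mean => /(congr1 (fun z => node z (Ordinal n_gt0))).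
by rewrite !node_stack.
Qed.

Lemma meanD x x' : mean (x + x') = mean x + mean x'.
Proof.
rewrite /mean -scalerDr -big_split /=; congr (_ *: _); apply: eq_bigr => i _.
by apply/colP => j; rewrite !mxE.
Qed.

Lemma meanZ a x : mean (a *: x) = a *: mean x.
Proof.
rewrite /mean scalerA mulrC -scalerA; congr (_ *: _); rewrite scaler_sumr.
by apply: eq_bigr => i _; apply/colP => j; rewrite !mxE.
Qed.

Lemma meanB x x' : mean (x - x') = mean x - mean x'.
Proof. by rewrite -(scaleN1r x') meanD meanZ scaleN1r. Qed.

Lemma mean_comm_lift W k x : doubly_stochastic W ->
  mean (comm_lift d k W *m x) = mean x.
Proof.
by move=> dsW; apply: mean_eq; rewrite mulmxA tensmx_mul averaging_expmx ?mulmx1.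
Qed.

Lemma comm_lift_stack_mean W k x : doubly_stochastic W ->
  comm_lift d k W *m stack (fun _ : 'I_n => mean x) = stack (fun _ => mean x).
Proof.
by move=> dsW; rewrite stack_mean mulmxA tensmx_mul expmx_averaging ?mulmx1.
Qed.

Lemma norm2_mean_le x : Num.sqrt n%:R * norm2 (mean x) <= norm2 x.
Proof.
rewrite -norm2_stack_cst stack_mean -[leRHS]mul1r.
apply: norm2_tensmx_le => // u; rewrite mul1r.
exact/doubly_stochastic_contracts/averaging_doubly_stochastic.
Qed.

Lemma norm2_comm_lift_le W k x : doubly_stochastic W ->
  norm2 (comm_lift d k W *m x) <= norm2 x.
Proof.
move=> dsW; rewrite -[leRHS]mul1r; apply: norm2_tensmx_le => // u.
rewrite -(expr1n _ k); apply: norm2_expmx_le => // v.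
by rewrite mul1r doubly_stochastic_contracts.
Qed.

Lemma opnorm2_comm_lift_sub1_le W k : doubly_stochastic W ->
  opnorm2 (comm_lift d k W - 1%:M) <= 2.
Proof.
move=> dsW; apply: opnorm2_le => // u; rewrite mulmxBl mul1mx.
apply: le_trans (norm2B _ _) _.
by rewrite mulr_natl mulr2n lerD2r norm2_comm_lift_le.
Qed.

Lemma beta_ge0 W : 0 <= beta W.
Proof. exact: opnorm2_ge0. Qed.

Let norm2_powers_le W k x :
  norm2 (((W - J) ^+ k *t (1%:M : 'M_d)) *m x) <= beta W ^+ k * norm2 x.
Proof.
apply: norm2_tensmx_le; first by rewrite exprn_ge0 ?beta_ge0.
by apply: norm2_expmx_le; [exact: beta_ge0|exact: norm2_mulmx_le].
Qed.

Lemma consensus_error_comm_lift W k x : doubly_stochastic W ->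
  norm2 (consensus_error (comm_lift d k W *m x))
    <= beta W ^+ k * norm2 (consensus_error x).
Proof.
move=> dsW; rewrite consensus_errorE mulmxA tensmx_mul mulmx1 centering_expmx //.
rewrite -(mulmx1 (1%:M : 'M[R]_d)) -tensmx_mul -mulmxA -consensus_errorE.
exact: norm2_powers_le.
Qed.

(** Centering is absorbed by W - J, so the consensus error contracts relatively
    to the vector itself as soon as one communication takes place. *)
Lemma consensus_error_comm_lift_le W k x : doubly_stochastic W -> (0 < k)%N ->
  norm2 (consensus_error (comm_lift d k W *m x)) <= beta W ^+ k * norm2 x.
Proof.
move=> dsW; case: k => // k _; have JJ := averaging_mulmx averaging_doubly_stochastic.
rewrite consensus_errorE mulmxA tensmx_mul mulmx1 centering_expmx //.
have -> : (W - J) ^+ k.+1 *m (1%:M - J) = (W - J) ^+ k.+1.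
  rewrite [_ ^+ k.+1]exprSr -mulmxA; congr (_ *m _).
  by rewrite mulmxBr mulmx1 mulmxBl JJ mulmx_averaging // subrr subr0.
exact: norm2_powers_le.
Qed.

End Averaging.

(** * Spectral radius and growth of powers *)

Section Modulus.
Variable R : realType.
Local Notation normc := (@Normc.normc R).
Implicit Types z w : R[i].

Lemma normc_ge0 z : 0 <= normc z.
Proof. by case: z => a b; exact: sqrtr_ge0. Qed.

Lemma normcD_le z w : normc (z + w) <= normc z + normc w.
Proof. exact: le_normcD. Qed.

Lemma normc_sum_le (I : Type) (r : seq I) (F : I -> R[i]) :
  normc (\sum_(i <- r) F i) <= \sum_(i <- r) normc (F i).
Proof.
elim: r => [|i r IH]; first by rewrite !big_nil Normc.normc0.
by rewrite !big_cons (le_trans (normcD_le _ _)) // lerD2l.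
Qed.

Lemma normc_real (a : R) : normc (real_complex R a) = `|a|.
Proof. by rewrite /= expr0n /= addr0 sqrtr_sqr. Qed.

End Modulus.

Section SpectralRadius.
Variables (R : realType) (m : nat).
Implicit Types (A : 'M[R]_m.+1) (M N : 'M[R[i]]_m.+1).
Local Notation normc := (@Normc.normc R).
Local Notation toC := (map_mx (real_complex R)).

Lemma char_poly_roots M : {rs : seq R[i] |
  char_poly M = \prod_(l <- rs) ('X - l%:P) & eigenvalue M =i rs}.
Proof.
have [rs e] := closed_field_poly_normal (char_poly M).
move: e; rewrite (monicP (char_poly_monic M)) scale1r => e; exists rs => // l.
rewrite -[_ \in eigenvalue M]/(eigenvalue M l) eigenvalue_root_char e.
by rewrite root_prod_XsubC.
Qed.

Lemma eigenvalue_le_spectral_radius A l :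
  eigenvalue (toC A) l -> normc l <= spectral_radius A.
Proof.
move=> Al; have [rs _ rsE] := char_poly_roots (toC A).
apply: ub_le_sup; last by exists l.
exists (\sum_(z <- rs) normc z) => _ [z /= Az <-].
have zrs : z \in rs by rewrite -rsE.
by rewrite (big_rem z) //= lerDl sumr_ge0 // => w _; exact: normc_ge0.
Qed.

Lemma spectral_radius_ge0 A : 0 <= spectral_radius A.
Proof.
have [rs e rsE] := char_poly_roots (toC A).
case: rs e rsE => [|l rs] e rsE.
  by have := size_char_poly (toC A); rewrite e big_nil size_poly1.
have Al : eigenvalue (toC A) l by have := rsE l; rewrite mem_head.
exact: le_trans (normc_ge0 l) (eigenvalue_le_spectral_radius Al).
Qed.

(** One factor is peeled off at a time.  With N' = (M - l) N, the products
    M ^+ k N satisfy M ^+ k.+1 N = l M ^+ k N + M ^+ k N', and a linear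
    recurrence of ratio l forced by a term of order s ^+ k is again of order
    s ^+ k because normc l < s. *)
Lemma annihilated_powers_le (rs : seq R[i]) M N (s : R) :
  0 < s -> (forall l, l \in rs -> normc l < s) ->
  \prod_(l <- rs) (M - l%:M) * N = 0 ->
  exists2 C : R, 0 <= C & forall k i j, normc ((M ^+ k * N) i j) <= C * s ^+ k.
Proof.
move=> s0; elim/last_ind: rs N => [|rs l IH] N rs_s.
  rewrite big_nil mul1r => ->; exists 0 => // k i j.
  by rewrite mulr0 mxE Normc.normc0 mul0r.
rewrite -cats1 big_cat /= big_seq1 -mulrA => annih.
have [|C C0 HC] := IH _ _ annih.
  by move=> z zrs; apply: rs_s; rewrite mem_rcons inE zrs orbT.
have ls : normc l < s by apply: rs_s; rewrite mem_rcons mem_head.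
have sl0 : 0 < s - normc l by rewrite subr_gt0.
(* The constant C / (s - normc l) is the least c such that
   normc l * c + C <= c * s. *)
pose C' := \sum_i \sum_j normc (N i j) + C / (s - normc l).
have q0 : 0 <= C / (s - normc l) by rewrite divr_ge0 // ltW.
have sum0 : 0 <= \sum_i \sum_j normc (N i j).
  by do 2![apply: sumr_ge0 => ? _]; exact: normc_ge0.
exists C' => [|k i j]; first exact: addr_ge0.
elim: k => [|k IHk].
  rewrite !expr0 mul1r mulr1 /C' (bigD1 i) //= (bigD1 j) //= -!addrA lerDl.
  rewrite !addr_ge0 //; first by apply: sumr_ge0 => ? _; exact: normc_ge0.
  by do 2![apply: sumr_ge0 => ? _]; exact: normc_ge0.
have -> : M ^+ k.+1 * N = l *: (M ^+ k * N) + M ^+ k * ((M - l%:M) * N).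
  rewrite mulrBl mulrBr mulrA -exprSr [l%:M * N]mul_scalar_mx -scalerAr.
  by rewrite addrC subrK.
rewrite mxE [X in X + _]mxE.
apply: le_trans (normcD_le _ _) _; rewrite Normc.normcM.
have h1 := ler_wpM2l (normc_ge0 l) IHk.
have h2 := HC k i j.
have h3 : C * s ^+ k <= C' * (s - normc l) * s ^+ k.
  apply: ler_wpM2r; first by rewrite exprn_ge0 // ltW.
  by rewrite -ler_pdivrMr // /C' lerDr.
by rewrite exprS; move: h1 h2 h3; lra.
Qed.

(** The characteristic polynomial splits over the complex numbers, so Cayley
    and Hamilton give a product of shifts M - l that vanishes, with l ranging
    over the eigenvalues. *)
Lemma powers_le_spectral_radius A (s : R) : spectral_radius A < s ->
  exists2 C : R, 0 <= C & forall k i j, `|(A ^+ k) i j| <= C * s ^+ k.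
Proof.
move=> rs; have s0 := le_lt_trans (spectral_radius_ge0 A) rs.
have [ls lsE eigE] := char_poly_roots (toC A).
have ls_s l : l \in ls -> normc l < s.
  rewrite -eigE => Al.
  exact: le_lt_trans (eigenvalue_le_spectral_radius Al) rs.
have := Cayley_Hamilton (toC A); rewrite lsE rmorph_prod /= => CH.
have [|C C0 HC] := @annihilated_powers_le ls (toC A) 1 s s0 ls_s.
  rewrite mulr1 -[RHS]CH; apply: eq_bigr => l _.
  by rewrite rmorphB /= horner_mx_X horner_mx_C.
exists C => // k i j; have := HC k i j.
by rewrite mulr1 -rmorphXn /= mxE normc_real.
Qed.

(** A left eigenvector u of the eigenvalue l satisfies
    |l| sum_j |u_j| v_j <= sum_i |u_i| (A v)_i, and the weights v_j make the
    right side at most t sum_j |u_j| v_j. *)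
Lemma spectral_radius_le A (v : 'cV[R]_m.+1) (t : R) :
  (forall i j, 0 <= A i j) -> (forall i, 0 < v i 0) ->
  (forall i, (A *m v) i 0 <= t * v i 0) -> spectral_radius A <= t.
Proof.
move=> A0 v0 Av; apply: ge_sup.
  have [[|l rs] e rsE] := char_poly_roots (toC A).
    by have := size_char_poly (toC A); rewrite e big_nil size_poly1.
  by exists (normc l), l => //=; have := rsE l; rewrite mem_head.
move=> _ [l /= /eigenvalueP [u uA u0] <-].
pose S := \sum_j normc (u 0 j) * v j 0.
have S_gt0 : 0 < S.
  have /rV0Pn [j uj] := u0.
  rewrite /S (bigD1 j) //= ltr_wpDr //.
    by apply: sumr_ge0 => i _; rewrite mulr_ge0 ?normc_ge0 // ltW.
  rewrite mulr_gt0 // lt_def normc_ge0 andbT.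
  by apply: contra uj => /eqP/Normc.eq0_normc ->.
rewrite -(ler_pM2r S_gt0) /S !mulr_sumr.
apply: (@le_trans _ _ (\sum_j (\sum_i normc (u 0 i) * A i j) * v j 0)).
  apply: ler_sum => j _; rewrite mulrA; apply: ler_wpM2r; first exact: ltW.
  rewrite -Normc.normcM.
  have -> : l * u 0 j = (u *m toC A) 0 j by rewrite uA mxE.
  rewrite mxE; apply: le_trans (normc_sum_le _ _) _.
  apply: ler_sum => i _.
  by rewrite Normc.normcM mxE normc_real ger0_norm.
under eq_bigr do rewrite mulr_suml.
rewrite exchange_big; apply: ler_sum => i _.
have -> : \sum_j normc (u 0 i) * A i j * v j 0 = normc (u 0 i) * (A *m v) i 0.
  by rewrite mxE mulr_sumr; apply: eq_bigr => j _; rewrite mulrA.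
by rewrite mulrCA ler_wpM2l ?normc_ge0.
Qed.

Lemma spectral_radius_lt1 A (v : 'cV[R]_m.+1) (e : R) :
  (forall i j, 0 <= A i j) -> (forall i, 0 < v i 0) -> 0 < e ->
  (forall i, (A *m v) i 0 + e <= v i 0) -> spectral_radius A < 1.
Proof.
move=> A0 v0 e0 Av; pose S := \sum_i v i 0.
have vS i : v i 0 <= S.
  by rewrite /S (bigD1 i) //= lerDl sumr_ge0 // => j _; exact: ltW.
have S_gt0 : 0 < S := lt_le_trans (v0 ord0) (vS ord0).
apply: (@le_lt_trans _ _ (1 - e / S)); last first.
  by rewrite ltrBlDr ltrDl divr_gt0.
apply: (@spectral_radius_le A v) => // i.
have : e / S * v i 0 <= e.
  by rewrite mulrAC ler_pdivrMr // ler_pM2l.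
by have := Av i; lra.
Qed.

End SpectralRadius.

Lemma iterate_mulmx_le (R : realType) (m : nat) (A : 'M[R]_m) (r : nat -> 'cV[R]_m) :
  (forall i j, 0 <= A i j) ->
  (forall k i, r k.+1 i 0 <= (A *m r k) i 0) ->
  forall k i, r k i 0 <= (A ^+ k *m r 0%N) i 0.
Proof.
move=> A0 step; elim=> [|k IH] i; first by rewrite expr0 mul1mx.
apply: le_trans (step k i) _; rewrite [A ^+ _]exprS -mulmxA !mxE.
by apply: ler_sum => j _; rewrite ler_wpM2l.
Qed.

(** The constant is chosen before r: it only comes from the growth of the
    powers of A. *)
Lemma linear_system_decay (R : realType) (m : nat) (A : 'M[R]_m.+1) (s : R) :
  (forall i j, 0 <= A i j) -> spectral_radius A < s ->
  exists2 C : R, 0 < C & forall r : nat -> 'cV[R]_m.+1,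
    (forall k i, 0 <= r k i 0) ->
    (forall k i, r k.+1 i 0 <= (A *m r k) i 0) ->
    forall k, norm2 (r k) <= C * s ^+ k * norm2 (r 0%N).
Proof.
move=> A0 As; have [C C0 HC] := powers_le_spectral_radius As.
have s0 := le_lt_trans (spectral_radius_ge0 A) As.
have coord_le (u : 'cV[R]_m.+1) i : u i 0 <= norm2 u.
  apply: le_trans (ler_norm _) _; rewrite -sqrtr_sqr ler_wsqrtr //.
  rewrite /dot (bigD1 i) //= expr2 lerDl sumr_ge0 // => j _.
  by rewrite -expr2 sqr_ge0.
have Ak_ge0 k i j : 0 <= (A ^+ k) i j.
  elim: k i j => [|k IH] i j; first by rewrite expr0 mxE ler0n.
  by rewrite [A ^+ _]exprS mxE sumr_ge0 // => l _; rewrite mulr_ge0.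
pose c : R := m.+1%:R; have c0 : 0 < c by rewrite ltr0n.
have cE b : c * b = \sum_(j < m.+1) b by rewrite sumr_const card_ord mulr_natl.
exists (c * c * C + 1) => [|r r0 step k]; first by rewrite ltr_wpDl ?mulr_ge0 // ltW.
set a := norm2 (r 0%N); have a0 : 0 <= a := norm2_ge0 _.
have sk0 : 0 <= s ^+ k by rewrite exprn_ge0 // ltW.
have rk i : r k i 0 <= c * (C * s ^+ k * a).
  apply: le_trans (iterate_mulmx_le A0 step k i) _; rewrite mxE.
  rewrite cE; apply: ler_sum => j _.
  have := HC k i j; move=> /(le_trans (ler_norm _)) h.
  exact: ler_pM (Ak_ge0 k i j) (r0 0%N j) h (coord_le (r 0%N) j).
apply: (@le_trans _ _ (c * c * C * s ^+ k * a)); last first.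
  by rewrite -!mulrA mulrDl mul1r -!mulrA lerDl mulr_ge0.
have b0 : 0 <= c * (C * s ^+ k * a) by rewrite !mulr_ge0 // ltW.
apply: norm2_le; first by rewrite !mulr_ge0 // ltW.
have -> : (c * c * C * s ^+ k * a) ^+ 2 = c * (c * (c * (C * s ^+ k * a)) ^+ 2).
  by ring.
apply: (@le_trans _ _ (c * (c * (C * s ^+ k * a)) ^+ 2)).
  rewrite cE; apply: ler_sum => i _.
  by rewrite expr2 ler_pM.
rewrite ler_pM2l // -[leLHS]mul1r ler_wpM2r ?sqr_ge0 //.
by rewrite /c ler1n.
Qed.

(** * Stability of the tracking matrix *)

Section Order3.
Variable R : realType.

Definition i0 : 'I_3 := @Ordinal 3 0 isT.
Definition i1 : 'I_3 := @Ordinal 3 1 isT.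
Definition i2 : 'I_3 := @Ordinal 3 2 isT.

Lemma forall_ord3 (P : 'I_3 -> Prop) : P i0 -> P i1 -> P i2 -> forall i, P i.
Proof.
by move=> P0 P1 P2 [[|[|[|//]]] lti];
  [move: P0|move: P1|move: P2]; congr P; apply: val_inj.
Qed.

Lemma sum_ord3 (F : 'I_3 -> R) : \sum_(i < 3) F i = F i0 + F i1 + F i2.
Proof.
rewrite !big_ord_recl big_ord0 addr0 addrA.
by congr (F _ + F _ + F _); apply: val_inj.
Qed.

(** The witness v is the vector of row sums of the adjugate of 1 - A, so that
    (1 - A) v is the constant vector of value \det (1 - A). *)
Lemma spectral_radius_lt1_order3 (A : 'M[R]_3) :
  (forall i j, 0 <= A i j) -> A i0 i2 = 0 -> A i1 i0 = 0 ->
  A i0 i0 < 1 -> A i1 i1 < 1 -> A i2 i2 < 1 ->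
  A i0 i1 * A i1 i2 * A i2 i0
    < (1 - A i0 i0) * ((1 - A i1 i1) * (1 - A i2 i2) - A i1 i2 * A i2 i1) ->
  spectral_radius A < 1.
Proof.
move=> A0 A02 A10.
set a := 1 - A i0 i0; set c := 1 - A i1 i1; set k := 1 - A i2 i2.
rewrite -subr_gt0 -/a => a0; rewrite -subr_gt0 -/c => c0.
rewrite -subr_gt0 -/k => k0; move: (A0 i0 i1) (A0 i1 i2) (A0 i2 i0) (A0 i2 i1).
set b := A i0 i1; set e := A i1 i2; set g := A i2 i0; set h := A i2 i1.
move=> b0 e0 g0 h0 det_gt0; pose D := c * k - e * h.
have D0 : 0 < D.
  rewrite -(pmulr_rgt0 _ a0); apply: le_lt_trans det_gt0.
  by rewrite !mulr_ge0.
pose v : 'cV[R]_3 := \col_i [:: D + b * k + b * e; e * g + a * k + a * e;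
                               c * g + a * h + b * g + a * c]`_i.
apply: (@spectral_radius_lt1 _ _ A v (a * D - b * e * g)) => //.
- have a0' := ltW a0; have c0' := ltW c0; have k0' := ltW k0.
  elim/forall_ord3; rewrite mxE /=.
  + by rewrite -addrA ltr_wpDr // addr_ge0 // mulr_ge0.
  + by rewrite ltr_wpDr ?mulr_ge0 // ltr_wpDl ?mulr_ge0 // mulr_gt0.
  + by rewrite ltr_wpDl ?mulr_gt0 // !addr_ge0 ?mulr_ge0.
- by rewrite subr_gt0.
elim/forall_ord3; rewrite mxE sum_ord3 ![v _ _]mxE /= ?A02 ?A10;
  rewrite -/b -/e -/g -/h ?mul0r ?add0r ?addr0.
- by rewrite (_ : A i0 i0 = 1 - a) /D; [lra|rewrite /a; lra].
- by rewrite (_ : A i1 i1 = 1 - c) /D; [lra|rewrite /c; lra].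
by rewrite (_ : A i2 i2 = 1 - k) /D; [lra|rewrite /k; lra].
Qed.

(** Otherwise the exchange of i with the last index puts A in block triangular
    form, with diagonal blocks of sizes 2 and 1. *)
Lemma irreducible_order3_row (A : 'M[R]_3) (i : 'I_3) :
  irreducible_mx A -> exists2 j, j != i & A i j != 0.
Proof.
move=> irr; apply: contrapT => Ai; apply: irr.
exists (tperm i i2), 2; split=> // p q p2 q2.
have -> : p = i2.
  by apply/val_inj/eqP; rewrite /= eqn_leq p2 -ltnS ltn_ord.
rewrite !mxE tpermR; apply/eqP/negPn/negP => Aq; apply: Ai.
exists (tperm i i2 q) => //; apply: contraTneq q2 => /(congr1 (tperm i i2)).
by rewrite tpermK tpermL => ->.
Qed.

End Order3.

(** The upper bound on alpha is the positive root of the quadratic equation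
    obtained by turning the conclusion into an equality.  The right side minus
    the left side, times alpha mu, is the determinant of 1 minus the tracking
    matrix with the norm of Z_1 ^ nc - 1 replaced by 2. *)
Lemma step_size_quadratic (R : realType) (mu L b1 b2 b3 b4 alpha : R) :
  0 < mu -> 0 < L -> b1 < 1 -> 0 < b2 -> b3 < 1 -> 0 < b4 -> 0 < alpha ->
  let kappa := L / mu in
  alpha < (1 - b1 + 2 * b2) / (2 * b2 * kappa * (L + mu))
     * (Num.sqrt (1 + 4 * (1 - b1) * (1 - b3) * b2 * (kappa + 1)
                      / (b4 * (1 - b1 + 2 * b2) ^+ 2)) - 1) ->
  alpha * b4 * L * (1 - b1 + 2 * b2)
    + alpha ^+ 2 * b2 * b4 * L ^+ 2 * (kappa + 1) < (1 - b1) * (1 - b3).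
Proof.
move=> mu0 L0; rewrite -subr_gt0 -[b3 < 1]subr_gt0.
move=> b10 b20 b30 b40 al0 kappa.
set c := 1 - b1 in b10 *; set q := 1 - b3 in b30 *; set P := c + 2 * b2.
have P0 : 0 < P by rewrite addr_gt0 ?mulr_gt0.
have k0 : 0 < kappa by rewrite divr_gt0.
have -> : 2 * b2 * kappa * (L + mu) = 2 * b2 * L * (kappa + 1).
  by rewrite /kappa; field; rewrite gt_eqF.
set S := 1 + _; set K := kappa + 1 in S *.
have K0 : 0 < K by rewrite addr_gt0.
set N := 2 * b2 * L * K; have N0 : 0 < N by rewrite !mulr_gt0.
have S0 : 0 <= S by rewrite addr_ge0 // ltW // divr_gt0 ?mulr_gt0 ?exprn_gt0.
rewrite mulrAC ltr_pdivlMr // [ltRHS]mulrC -ltr_pdivrMr // ltrBrDr => h.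
have w0 : 0 <= alpha * N / P + 1 by rewrite addr_ge0 // ltW // divr_gt0 ?mulr_gt0.
have : (alpha * N / P + 1) ^+ 2 < S.
  by rewrite -[ltRHS](sqr_sqrtr S0) ltr_pXn2r ?nnegrE ?sqrtr_ge0.
have -> : (alpha * N / P + 1) ^+ 2
    = 1 + ((alpha * N / P) ^+ 2 + 2 * (alpha * N / P)) by ring.
rewrite /S ltrD2l.
rewrite ltr_pdivlMr ?mulr_gt0 ?exprn_gt0 // => quad.
have f0 : 0 < 4 * b2 * K by rewrite !mulr_gt0.
rewrite -(ltr_pM2l f0).
have -> : 4 * b2 * K * (c * q) = 4 * c * q * b2 * K by ring.
move: quad; congr (_ < _); rewrite /N -mulr_natl; field; rewrite gt_eqF //.
Qed.

(** * One iteration of gradient tracking *)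

Lemma gradient_average (R : realType) (n d : nat) (f : 'I_n -> 'cV[R]_d -> R)
    (z : 'cV[R]_d) : (forall i, differentiable (f i) z) ->
  gradient (average f) z
    = mean (stacked_gradient f (stack (fun _ : 'I_n => z))).
Proof.
move=> df; apply/colP => j; rewrite mxE.
have -> : average f = n%:R^-1 \*: (\sum_(i < n) f i).
  by apply/funext => w; rewrite /average /= fct_sumE.
have dfj i : derivable (f i) z (delta_mx j 0) by exact: diff_derivable.
rewrite deriveZ; last exact: derivable_sum.
rewrite derive_sum // !mxE summxE; congr (_ * _).
by apply: eq_bigr => i _; rewrite !node_stack mxE.
Qed.

Lemma lipschitz_gradient_ge0 (R : realType) (d : nat) (L : R)
    (g : 'cV[R]_d -> R) : (0 < d)%N -> lipschitz_gradient L g -> 0 <= L.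
Proof.
move=> d_gt0 /(_ (delta_mx (Ordinal d_gt0) 0) 0); rewrite subr0 norm2_delta mulr1.
exact: le_trans (norm2_ge0 _).
Qed.

Section OneStep.
Variables (R : realType) (n d nc : nat) (f : 'I_n -> 'cV[R]_d -> R) (mu L : R).
Variables (W1 W2 W3 W4 : 'M[R]_n) (alpha : R) (xstar : 'cV[R]_d).

Hypothesis n_gt0 : (0 < n)%N.
Hypothesis nc_gt0 : (0 < nc)%N.
Hypothesis f_diff : forall i (z : 'cV[R]_d), differentiable (f i) z.
Hypothesis L_ge0 : 0 <= L.
Hypothesis mu_gt0 : 0 < mu.
Hypothesis muL : mu <= L.
Hypothesis f_sc : strongly_convex mu (average f).
Hypothesis f_lip : forall i, lipschitz_gradient L (f i).
Hypothesis xstar_min : minimizer (average f) xstar.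
Hypothesis dsW1 : doubly_stochastic W1.
Hypothesis dsW2 : doubly_stochastic W2.
Hypothesis dsW3 : doubly_stochastic W3.
Hypothesis dsW4 : doubly_stochastic W4.
Hypothesis alpha_gt0 : 0 < alpha.
Hypothesis alphaL : alpha * L < 1.

Local Notation G := (gradient (average f)).
Local Notation SG := (stacked_gradient f).
Local Notation cst z := (stack (fun _ : 'I_n => z)).
Local Notation sn := (Num.sqrt (n%:R : R)).

Let L_gt0 : 0 < L. Proof. exact: lt_le_trans muL. Qed.
Let sn_gt0 : 0 < sn. Proof. by rewrite sqrtr_gt0 ltr0n. Qed.

Lemma stacked_gradient_lipschitz (x x' : 'cV[R]_(n * d)) :
  norm2 (SG x - SG x') <= L * norm2 (x - x').
Proof.
apply: norm2_le; first by rewrite mulr_ge0 ?norm2_ge0.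
rewrite -sqr_norm2 exprMn !norm2_node mulr_sumr; apply: ler_sum => i _.
rewrite -exprMn ler_pXn2r ?nnegrE ?mulr_ge0 ?norm2_ge0 //.
by rewrite !nodeB !node_stack; exact: f_lip.
Qed.

(** At a stack of n equal copies of z, the stacked gradient averages to the
    gradient of f at z, so all errors on gradients are measured against the
    consensus point. *)
Lemma mean_gradient_error (x : 'cV[R]_(n * d)) :
  sn * norm2 (mean (SG x) - G (mean x)) <= L * norm2 (consensus_error x).
Proof.
rewrite gradient_average // -meanB.
apply: le_trans (norm2_mean_le n_gt0 _) _.
exact: stacked_gradient_lipschitz.
Qed.

Lemma average_lipschitz (z z' : 'cV[R]_d) : norm2 (G z - G z') <= L * norm2 (z - z').
Proof.
rewrite !gradient_average // -meanB -(ler_pM2l sn_gt0).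
apply: le_trans (norm2_mean_le n_gt0 _) _.
apply: le_trans (stacked_gradient_lipschitz _ _) _.
have -> : cst z - cst z' = cst (z - z') by apply/colP => k; rewrite !mxE.
by rewrite norm2_stack_cst mulrCA.
Qed.

Let G_xstar : G xstar = 0.
Proof.
exact: (@gradient_minimizer_eq0 _ _ _ _ _ G mu_gt0 f_sc average_lipschitz).
Qed.

Section Iterate.
Variables (x y x' y' : 'cV[R]_(n * d)).
Hypothesis mean_y : mean y = mean (SG x).
Hypothesis x'E :
  x' = comm_lift d nc W1 *m x - alpha *: (comm_lift d nc W2 *m y).
Hypothesis y'E :
  y' = comm_lift d nc W3 *m y + comm_lift d nc W4 *m (SG x' - SG x).

(** Doubly stochastic communication preserves means, so the trackers y keep
    averaging to the mean of the current local gradients. *)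
Lemma tracking_invariant : mean y' = mean (SG x').
Proof. by rewrite y'E meanD !mean_comm_lift // meanB mean_y addrC subrK. Qed.

Lemma optimality_error_step :
  norm2 (mean x' - xstar) <= (1 - alpha * mu) * norm2 (mean x - xstar)
    + alpha * L / sn * norm2 (consensus_error x).
Proof.
have -> : mean x' - xstar
    = (mean x - xstar - alpha *: (G (mean x) - G xstar))
      - alpha *: (mean (SG x) - G (mean x)).
  rewrite x'E meanB meanZ !mean_comm_lift // mean_y G_xstar subr0.
  by apply/colP => j; rewrite !mxE; ring.
apply: le_trans (norm2B _ _) _; apply: lerD.
  exact: (@gradient_step_contraction _ _ _ _ _ G mu_gt0 f_sc average_lipschitz).
rewrite norm2Z gtr0_norm // -!mulrA ler_pM2l // mulrCA -ler_pdivrMl ?invr_gt0 //.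
rewrite invrK; exact: mean_gradient_error.
Qed.

Lemma consensus_error_step :
  norm2 (consensus_error x') <= beta W1 ^+ nc * norm2 (consensus_error x)
    + alpha * beta W2 ^+ nc * norm2 (consensus_error y).
Proof.
rewrite x'E -scaleNr consensus_errorD consensus_errorZ.
apply: le_trans (norm2D _ _) _; apply: lerD.
  exact: consensus_error_comm_lift.
rewrite norm2Z normrN gtr0_norm // -mulrA ler_pM2l //.
exact: consensus_error_comm_lift.
Qed.

(** The displacement of the iterates is the communication residual, which only
    sees the consensus part of x, plus the step along y, whose mean part is the
    gradient of f up to the consensus error. *)
Lemma displacement_le :
  norm2 (x' - x)
    <= sn * alpha * L * norm2 (mean x - xstar)
       + (opnorm2 (comm_lift d nc W1 - 1%:M) + alpha * L)
         * norm2 (consensus_error x)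
       + alpha * norm2 (consensus_error y).
Proof.
have split_mean z : z = consensus_error z + cst (mean z) by rewrite subrK.
have -> : x' - x = (comm_lift d nc W1 - 1%:M) *m consensus_error x
                   - alpha *: (comm_lift d nc W2 *m y).
  rewrite mulmxBr mulmxBl mul1mx mulmxBl comm_lift_stack_mean // mul1mx subrr.
  by rewrite subr0 x'E addrAC.
apply: le_trans (norm2B _ _) _; rewrite norm2Z gtr0_norm //.
have h1 := norm2_mulmx_le (comm_lift d nc W1 - 1%:M) (consensus_error x).
have h2 : norm2 (comm_lift d nc W2 *m y)
    <= norm2 (consensus_error y) + sn * norm2 (mean y).
  apply: le_trans (norm2_comm_lift_le _ _ dsW2) _.
  by rewrite {1}[y]split_mean -norm2_stack_cst norm2D.
have h3 : sn * norm2 (mean y) <= L * norm2 (consensus_error x)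
                                 + sn * (L * norm2 (mean x - xstar)).
  rewrite mean_y -[mean (SG x)](subrK (G (mean x))).
  apply: le_trans (ler_wpM2l (ltW sn_gt0) (norm2D _ _)) _.
  rewrite mulrDr lerD ?mean_gradient_error // ler_pM2l //.
  by have := average_lipschitz (mean x) xstar; rewrite G_xstar subr0.
by have := ler_wpM2l (ltW alpha_gt0) (le_trans h2 (lerD (lexx _) h3)); move: h1; lra.
Qed.

Lemma tracking_error_step :
  norm2 (consensus_error y')
    <= beta W3 ^+ nc * norm2 (consensus_error y)
       + beta W4 ^+ nc * L * norm2 (x' - x).
Proof.
rewrite y'E consensus_errorD; apply: le_trans (norm2D _ _) _; apply: lerD.
  exact: consensus_error_comm_lift.
apply: le_trans (consensus_error_comm_lift_le _ _ _ _) _ => //.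
rewrite -mulrA ler_wpM2l ?exprn_ge0 ?beta_ge0 //.
exact: stacked_gradient_lipschitz.
Qed.

Lemma error_vector_step i :
  error_vector xstar x' y' i 0
    <= (tracking_matrix d nc W1 W2 W3 W4 mu L alpha
        *m error_vector xstar x y) i 0.
Proof.
elim/forall_ord3: i; rewrite [leRHS]mxE sum_ord3 !mxE /=.
- by rewrite mul0r addr0 optimality_error_step.
- by rewrite mul0r add0r consensus_error_step.
apply: le_trans tracking_error_step _.
have b4L : 0 <= beta W4 ^+ nc * L by rewrite mulr_ge0 ?exprn_ge0 ?beta_ge0.
by have := ler_wpM2l b4L displacement_le; lra.
Qed.

End Iterate.

End OneStep.

(** * Linear convergence *)

Lemma tracking_matrix_ge0 (R : realType) (n d nc : nat) (W1 W2 W3 W4 : 'M[R]_n)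
    (mu L alpha : R) : 0 <= L -> 0 <= alpha -> alpha * mu <= 1 ->
  forall i j, 0 <= tracking_matrix d nc W1 W2 W3 W4 mu L alpha i j.
Proof.
move=> L0 al0 almu i j; rewrite mxE.
have bk (W : 'M[R]_n) : 0 <= beta W ^+ nc by rewrite exprn_ge0 ?beta_ge0.
have z0 := opnorm2_ge0 (comm_lift d nc W1 - 1%:M).
have s0 := sqrtr_ge0 (n%:R : R).
elim/forall_ord3: i; elim/forall_ord3: j => //=;
  rewrite ?subr_ge0 ?divr_ge0 ?addr_ge0 ?mulr_ge0 ?addr_ge0 ?mulr_ge0 ?sqr_ge0 //.
Qed.

Theorem theorem4 (R : realType) (n d nc : nat)
  (n_gt0 : (0 < n)%N) (d_gt0 : (0 < d)%N) (nc_ge1 : (1 <= nc)%N)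
  (f : 'I_n -> 'cV[R]_d -> R) (mu L : R)
  (f_diff : forall (i : 'I_n) (z : 'cV[R]_d), differentiable (f i) z)
  (mu_gt0 : 0 < mu) (f_sc : strongly_convex mu (average f))
  (f_lip : forall i : 'I_n, lipschitz_gradient L (f i))
  (xstar : 'cV[R]_d) (xstar_min : unique_minimizer (average f) xstar)
  (E : rel 'I_n) (E_conn : connected_graph E)
  (W1 W2 W3 W4 : 'M[R]_n)
  (W1_comm : communication_matrix E W1) (W2_comm : communication_matrix E W2)
  (W3_comm : communication_matrix E W3) (W4_comm : communication_matrix E W4)
  (alpha : R) (alpha_gt0 : 0 < alpha) :
  let A := tracking_matrix d nc W1 W2 W3 W4 mu L alpha in
  let kappa := L / mu in
  let b1 := beta W1 ^+ nc in
  let b2 := beta W2 ^+ nc in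
  let b3 := beta W3 ^+ nc in
  let b4 := beta W4 ^+ nc in
  irreducible_mx A ->
  beta W1 < 1 -> beta W3 < 1 ->
  alpha < Num.min (1 / L) (Num.min ((1 - b3) / (L * b4))
    ((1 - b1 + 2 * b2) / (2 * b2 * kappa * (L + mu))
     * (Num.sqrt (1 + 4 * (1 - b1) * (1 - b3) * b2 * (kappa + 1)
                      / (b4 * (1 - b1 + 2 * b2) ^+ 2)) - 1))) ->
  spectral_radius A < 1 /\
  forall eps : R, 0 < eps ->
    exists2 C : R, 0 < C &
      forall x y : nat -> 'cV[R]_(n * d),
        gradient_tracking nc W1 W2 W3 W4 f alpha x y ->
        forall k : nat,
          norm2 (error_vector xstar (x k) (y k))
          <= C * (spectral_radius A + eps) ^+ k
             * norm2 (error_vector xstar (x 0%N) (y 0%N)).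
Proof.
move=> A kappa b1 b2 b3 b4 irr beta1 beta3.
rewrite !lt_min => /and3P [step1 step3 step_quad].
have L_ge0 := lipschitz_gradient_ge0 d_gt0 (f_lip (Ordinal n_gt0)).
have muL : mu <= L.
  apply: (@strong_convexity_le_lipschitz _ _ _ _ _ (gradient (average f)) f_sc) => //.
  exact: average_lipschitz.
have L_gt0 := lt_le_trans mu_gt0 muL.
have alphaL : alpha * L < 1 by rewrite -ltr_pdivlMr.
have alphamu : alpha * mu < 1 by rewrite (le_lt_trans _ alphaL) // ler_pM2l.
have ds W := @communication_matrix_doubly_stochastic R n E W.
have [/ds dsW1 /ds dsW2 /ds dsW3 /ds dsW4] := (And4 W1_comm W2_comm W3_comm W4_comm).
have bk_ge0 (W : 'M[R]_n) : 0 <= beta W ^+ nc by rewrite exprn_ge0 ?beta_ge0.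
have bk_lt1 (W : 'M[R]_n) : beta W < 1 -> beta W ^+ nc < 1.
  by move=> h; rewrite exprn_ilt1 ?beta_ge0 // -lt0n.
(* A zero value of b2 or b4 would clear the off-diagonal entries of a row. *)
have b2_gt0 : 0 < b2.
  have [j] := irreducible_order3_row i1 irr; rewrite lt_def bk_ge0 andbT.
  elim/forall_ord3: j => // _; rewrite mxE /= ?eqxx //.
  by apply: contraNneq => b20; rewrite -/b2 b20 mulr0.
have b4_gt0 : 0 < b4.
  have [j] := irreducible_order3_row i2 irr; rewrite lt_def bk_ge0 andbT.
  by elim/forall_ord3: j => // _; rewrite mxE /=; apply: contraNneq => b40;
    rewrite -/b4 b40 !(mulr0, mul0r).
have A_ge0 : forall i j, 0 <= A i j.
  by apply: tracking_matrix_ge0; rewrite ?ltW.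
have sn_gt0 : 0 < Num.sqrt (n%:R : R) by rewrite sqrtr_gt0 ltr0n.
have rho_lt1 : spectral_radius A < 1.
  apply: spectral_radius_lt1_order3 => //; rewrite ?[A _ _]mxE //=.
  - by rewrite gtrBl mulr_gt0.
  - exact: bk_lt1.
  - rewrite -ltrBrDl -mulrA [b4 * L]mulrC -ltr_pdivlMr ?mulr_gt0 //.
  rewrite -/b1 -/b2 -/b3 -/b4.
  have quad := step_size_quadratic mu_gt0 L_gt0 (bk_lt1 _ beta1) b2_gt0
    (bk_lt1 _ beta3) b4_gt0 alpha_gt0 step_quad.
  have z2 := opnorm2_comm_lift_sub1_le d nc dsW1.
  set z := opnorm2 _ in z2 *; set sn := Num.sqrt _ in sn_gt0 *.
  have -> : alpha * L / sn * (alpha * b2) * (sn * alpha * b4 * L ^+ 2)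
      = alpha * (alpha ^+ 2 * b2 * b4 * L ^+ 3).
    by field; rewrite gt_eqF.
  rewrite [1 - (1 - _)]subKr -[alpha * mu * _]mulrA ltr_pM2l //.
  have zq : alpha * b2 * b4 * L * z <= alpha * b2 * b4 * L * 2.
    by rewrite ler_pM2l // !mulr_gt0.
  rewrite -ltr_pdivrMl //.
  have -> : mu^-1 * (alpha ^+ 2 * b2 * b4 * L ^+ 3)
      = alpha ^+ 2 * b2 * b4 * L ^+ 2 * kappa.
    by rewrite /kappa; field; rewrite gt_eqF.
  by move: quad zq; rewrite -/b1 -/b2 -/b3 -/b4 -/kappa; lra.
split=> // eps eps_gt0.
have [|C C_gt0 decay] := @linear_system_decay R 2 A (spectral_radius A + eps) A_ge0.
  by rewrite ltrDl.
exists C => // x y [y0 xS yS] k.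
have mean_y j : mean (y j) = mean (stacked_gradient f (x j)).
  by elim: j => [|j IH]; [rewrite y0|exact: tracking_invariant IH (yS j)].
apply: (decay (fun j => error_vector xstar (x j) (y j))) => [j i|j i].
  by rewrite mxE; elim/forall_ord3: i; exact: norm2_ge0.
by apply: error_vector_step => //; exact: proj1 xstar_min.
Qed.
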